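(* The following two statements are equivalent. (i) There exist constants $\delta$ and $K$ such that for every integer $N\ge 2$ and all complex numbers $a_1,\dots,a_N$, the trigonometric polynomial $f(\theta)=\sum_{k=1}^N a_k e(k^2\theta)$ satisfies $\|f\|_4\le K\,\|f\|_2\,(\log N)^{\delta}$. (ii) There exist constants $C>0$ and $K'$ such that for every integer $N\ge2$ and every set $E\subset\{1^2,2^2,\dots,N^2\}$ one has $\sum_m r_{E+E}(m)^2\le K'\,|E|^2(\log N)^C$.
   Context: $e(\theta)=e^{2\pi i\theta}$; for a trigonometric polynomial $f$, $\|f\|_p^p=\int_0^1|f(t)|^p\,dt$. For a finite set $E$ of integers, $r_{E+E}(m)=\#\{(x,y)\in E\times E:x+y=m\}$. *)

(* Defs.v *)
From mathcomp Require Import all_boot all_order all_algebra.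
From mathcomp Require Import finmap.
From mathcomp Require Import complex.
From mathcomp Require Import all_classical all_reals all_analysis.

Set Implicit Arguments.
Unset Strict Implicit.
Unset Printing Implicit Defensive.

Import Order.TTheory GRing.Theory Num.Theory.

Local Open Scope ring_scope.
Local Open Scope complex_scope.

(* MathComp-Analysis has no complex exponential, so e^(2 pi i theta) is given
   by its real and imaginary parts. *)
Definition e (R : realType) (theta : R) : R[i] :=
  cos (2 * pi * theta) +i* sin (2 * pi * theta).

(* Only the values a 1, ..., a N of the coefficient sequence are used. *)
Definition squares_poly (R : realType) (N : nat) (a : nat -> R[i])
    (theta : R) : R[i] :=
  \sum_(1 <= k < N.+1) a k * e ((k ^ 2)%:R * theta).

(* [normc] is the R-valued modulus; the norm `|z| of R[i] is R[i]-valued. *)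
Definition Lpnorm (R : realType) (p : R) (f : R -> R[i]) : R :=
  (\int[@lebesgue_measure R]_(t in `[0%R, 1%R]%classic)
     (ComplexField.Normc.normc (f t) `^ p)) `^ p^-1.

Definition squares (N : nat) : {fset int} :=
  [fset (k ^ 2)%:Z | k in iota 1 N]%fset.

Definition rep_count (E : {fset int}) (m : int) : nat :=
  #|` [fset xy in (E `*` E)%fset | (xy.1 + xy.2 == m)%R]%fset |.

(* The sum ranges over all integers m; [rep_count E] has finite support, being
   zero off E + E, so the finitely supported sum is the intended one. *)
Definition energy (R : realType) (E : {fset int}) : R :=
  \sum_(m \in [set: int]%classic) ((rep_count E m)%:R ^+ 2 : R).

(* Main.v *)
Require Import Defs.
From mathcomp Require Import all_boot all_order all_algebra.
From mathcomp Require Import finmap.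
From mathcomp Require Import complex.
From mathcomp Require Import all_classical all_reals all_analysis.
From mathcomp Require Import ring lra.

Set Implicit Arguments.
Unset Strict Implicit.
Unset Printing Implicit Defensive.

Import Order.TTheory GRing.Theory Num.Theory.
Import numFieldNormedType.Exports.
Import ComplexField.Normc.

Local Open Scope ring_scope.

(* By orthogonality, the fourth moment of the sum of e(k^2 t) over k^2 in E is
   the additive energy of E, and its second moment is |E|; so (i) for 0/1
   coefficients is (ii).  Conversely, cut the coefficients into about log N
   dyadic levels M/2^(l+1) < |a_k| <= M/2^l, with M the l^2 norm of a, and one
   last level |a_k| <= M/2^J where 2^J >= N.  On the level l, (ii) bounds the
   fourth moment by the energy of the level times (M/2^l)^4, which is
   O(M^4 (log N)^C), and convexity of x^4 loses only (J + 1)^4, a power of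
   log N, when the levels are put together. *)

(** * Integrals over one period and orthogonality of characters *)

Lemma sin_2piz (R : realType) (m : int) : sin (2 * pi * m%:~R) = 0 :> R.
Proof.
have nat_case (n : nat) : sin (2 * pi * n%:R) = 0 :> R.
  have -> : 2 * pi * n%:R = 0 + pi *+ 2 *+ n :> R.
    by rewrite add0r -(mulr_natr (pi *+ 2)) -(mulr_natr pi); ring.
  by rewrite (periodicn (@sinD2pi R)) sin0.
(* Periodicity settles the natural multiples; oddness of the sine carries them over to negative
   integers. *)
case: m => n; first exact: nat_case.
by rewrite NegzE mulrNz mulrN sinN nat_case oppr0.
Qed.

Lemma cos_2piz (R : realType) (m : int) : cos (2 * pi * m%:~R) = 1 :> R.
Proof.
have nat_case (n : nat) : cos (2 * pi * n%:R) = 1 :> R.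
  have -> : 2 * pi * n%:R = 0 + pi *+ 2 *+ n :> R.
    by rewrite add0r -(mulr_natr (pi *+ 2)) -(mulr_natr pi); ring.
  by rewrite (periodicn (@cosD2pi R)) cos0.
case: m => n; first exact: nat_case.
by rewrite NegzE mulrNz mulrN cosN nat_case.
Qed.

Definition mean (R : realType) (f : R -> R) : R :=
  \int[@lebesgue_measure R]_(t in `[0%R, 1%R]%classic) f t.

Section mean.
Context {R : realType}.
Implicit Types f g F : R -> R.

Lemma mean_derive (f F : R -> R) : continuous f ->
  (forall x : R, is_derive x (1 : R) F (f x)) -> mean f = F 1 - F 0.
Proof.
move=> cf dF; rewrite /mean /Rintegral (@continuous_FTC2 _ f F 0 1) ?ltr01//.
- exact: continuous_subspaceT.
- have cF x : {for x, continuous F}.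
    by apply/differentiable_continuous/derivable1_diffP; case: (dF x).
  split => [x _||]; first by case: (dF x).
  + exact: cvg_at_right_filter (cF 0).
  + exact: cvg_at_left_filter (cF 1).
- by move=> x _; rewrite derive1E; apply: derive_val.
Qed.

Lemma continuous_integrable01 (f : R -> R) : continuous f ->
  lebesgue_measure.-integrable `[0, 1]%classic (EFin \o f).
Proof.
move=> cf; apply: continuous_compact_integrable; first exact: segment_compact.
exact: continuous_subspaceT.
Qed.

Lemma meanD f g : continuous f -> continuous g ->
  mean (fun t => f t + g t) = mean f + mean g.
Proof.
move=> cf cg; rewrite /mean RintegralD //; exact: continuous_integrable01.
Qed.

Lemma meanZ c f : continuous f -> mean (fun t => c * f t) = c * mean f.
Proof.
by move=> cf; rewrite /mean RintegralZl //; exact: continuous_integrable01.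
Qed.

Lemma mean_le f g : continuous f -> continuous g -> (forall t, f t <= g t) ->
  mean f <= mean g.
Proof.
by move=> cf cg fg; apply: le_Rintegral => //; exact: continuous_integrable01.
Qed.

Lemma continuous_sumf (I : Type) (s : seq I) (f : I -> R -> R) :
  (forall i, continuous (f i)) -> continuous (fun t => \sum_(i <- s) f i t).
Proof.
move=> cf; elim: s => [|i s IHs] x.
  by under eq_fun do rewrite big_nil; exact: cvg_cst.
under eq_fun do rewrite big_cons; apply: cvgD; [exact: cf|exact: IHs].
Qed.

Lemma mean_sum (I : Type) (s : seq I) (f : I -> R -> R) :
  (forall i, continuous (f i)) ->
  mean (fun t => \sum_(i <- s) f i t) = \sum_(i <- s) mean (f i).
Proof.
move=> cf; elim: s => [|i s IHs].
  under eq_fun do rewrite big_nil.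
  by rewrite /mean Rintegral_cst// mul0r big_nil.
under eq_fun do rewrite big_cons; rewrite big_cons -IHs meanD//.
exact: continuous_sumf.
Qed.

Lemma continuous_cosZ (c : R) : continuous (fun t => cos (c * t)).
Proof.
move=> x; apply: (@continuous_comp _ _ _ (fun t => c * t) cos).
  by apply: cvgM; [exact: cvg_cst|exact: cvg_id].
exact: continuous_cos.
Qed.

Lemma continuous_sinZ (c : R) : continuous (fun t => sin (c * t)).
Proof.
move=> x; apply: (@continuous_comp _ _ _ (fun t => c * t) sin).
  by apply: cvgM; [exact: cvg_cst|exact: cvg_id].
exact: continuous_sin.
Qed.

(** For nonzero [m] the antiderivative [c^-1 * sin (c * t)], with [c = 2 * pi * m], vanishes at both
    ends of the period. Together with [mean_sin] this is the orthogonality of the characters. *)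
Lemma mean_cos (m : int) :
  mean (fun t : R => cos (2 * pi * m%:~R * t)) = (m == 0)%:R.
Proof.
have [->|m0] := eqVneq m 0.
  under eq_fun do rewrite mulr0 mul0r cos0.
  rewrite /mean Rintegral_cst// mul1r /= lebesgue_measure_itv /= lte_fin ltr01.
  by rewrite oppr0 adde0.
set c : R := 2 * pi * m%:~R.
have c0 : c != 0 by rewrite !mulf_neq0 ?intr_eq0 ?pnatr_eq0 // gt_eqF ?pi_gt0.
have dF (x : R) : is_derive x (1 : R)
    (fun t => c^-1 * sin (c * t)) (cos (c * x)).
  have h := is_derive_sin (c * x); apply: is_derive_eq.
  by rewrite /GRing.scale/=; field.
rewrite (mean_derive _ dF); last exact: continuous_cosZ.
by rewrite mulr1 mulr0 sin0 sin_2piz !mulr0 subrr.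
Qed.

Lemma mean_sin (m : int) :
  mean (fun t : R => sin (2 * pi * m%:~R * t)) = 0.
Proof.
have [->|m0] := eqVneq m 0.
  under eq_fun do rewrite mulr0 mul0r sin0.
  by rewrite /mean Rintegral_cst// mul0r.
set c : R := 2 * pi * m%:~R.
have c0 : c != 0 by rewrite !mulf_neq0 ?intr_eq0 ?pnatr_eq0 // gt_eqF ?pi_gt0.
have dF (x : R) : is_derive x (1 : R)
    (fun t => - c^-1 * cos (c * t)) (sin (c * x)).
  have h := is_derive_cos (c * x); apply: is_derive_eq.
  by rewrite /GRing.scale/=; field.
rewrite (mean_derive _ dF); last exact: continuous_sinZ.
by rewrite mulr1 mulr0 cos0 cos_2piz subrr.
Qed.
End mean.

(** * The complex modulus and an elementary inequality *)

Section normc.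
Context {R : realType}.
Implicit Types z w : R[i].

Lemma normc_ge0 z : 0 <= normc z.
Proof. by case: z => a b; exact: sqrtr_ge0. Qed.

Lemma sqr_normc_Re z : normc z ^+ 2 = complex.Re (z * z^*%C).
Proof.
case: z => a b /=; rewrite sqr_sqrtr ?addr_ge0 ?sqr_ge0//.
by rewrite mulrN opprK !expr2.
Qed.

Lemma normcX z n : normc (z ^+ n) = normc z ^+ n.
Proof.
by elim: n => [|n IHn]; rewrite ?expr0 ?normc1// !exprS normcM IHn.
Qed.

Lemma Re_le_normc z : complex.Re z <= normc z.
Proof.
case: z => a b /=; apply: (le_trans (ler_norm a)).
by rewrite -sqrtr_sqr ler_wsqrtr// lerDl sqr_ge0.
Qed.

Lemma normc_conj z : normc (z^*%C) = normc z.
Proof. by case: z => a b /=; rewrite sqrrN. Qed.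

Lemma Re_sum (I : Type) (s : seq I) (F : I -> R[i]) :
  complex.Re (\sum_(i <- s) F i) = \sum_(i <- s) complex.Re (F i).
Proof.
elim: s => [|i s IHs]; rewrite ?big_nil// !big_cons -IHs.
by case: (F i); case: (\sum_(j <- s) F j).
Qed.

Lemma eD (x y : R) : e (x + y) = e x * e y.
Proof.
rewrite /e mulrDr cosD sinD; apply/eqP; rewrite eq_complex /=.
by rewrite [X in _ && (_ == X)]addrC !eqxx.
Qed.

Lemma normc_sum (I : Type) (s : seq I) (F : I -> R[i]) :
  normc (\sum_(i <- s) F i) <= \sum_(i <- s) normc (F i).
Proof.
elim: s => [|i s IHs]; first by rewrite !big_nil normc0.
rewrite !big_cons; apply: le_trans (le_normcD _ _) _.
by rewrite lerD2l.
Qed.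

End normc.

(** Cauchy-Schwarz against the constant 1: with [n = size s], the nonnegative double sum of
    [(x i - x j) ^+ 2] expands to [2 * n * Q - 2 * S ^+ 2]. *)
Lemma sqr_sum_le (R : realType) (I : Type) (s : seq I) (x : I -> R) :
  (\sum_(i <- s) x i) ^+ 2 <= (size s)%:R * \sum_(i <- s) x i ^+ 2.
Proof.
set Q := \sum_(i <- s) x i ^+ 2; set S := \sum_(i <- s) x i.
have: 0 <= \sum_(i <- s) \sum_(j <- s) (x i - x j) ^+ 2.
  by do 2 (apply: sumr_ge0 => ? _); exact: sqr_ge0.
have row i : \sum_(j <- s) (x i - x j) ^+ 2 =
    (size s)%:R * x i ^+ 2 - 2 * S * x i + Q.
  under eq_bigr => j _ do
    (have -> : (x i - x j) ^+ 2 = x i ^+ 2 + - 2 * x i * x j + x j ^+ 2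
       by ring).
  rewrite !big_split /= big_const_seq count_predT iter_addr_0 -mulr_sumr.
  by rewrite -/S -/Q; ring.
under eq_bigr do rewrite row.
rewrite !big_split /= big_const_seq count_predT iter_addr_0 sumrN -!mulr_sumr.
by rewrite -/S -/Q -mulr_natl; lra.
Qed.

(** * Second and fourth moments of trigonometric polynomials *)

Definition trig_poly (R : realType) (I : Type) (s : seq I) (freq : I -> int)
    (b : I -> R[i]) (t : R) : R[i] :=
  \sum_(i <- s) b i * e ((freq i)%:~R * t).

Section trig_poly.
Context {R : realType}.

(** Multiplying by the conjugate gives a double sum of characters at the frequency differences.
    Taking real parts puts it in a form to which the real integral applies. *)
Lemma sqr_normc_trig_poly (I : Type) (s : seq I) (freq : I -> int)
    (b : I -> R[i]) (t : R) :
  normc (trig_poly s freq b t) ^+ 2 =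
  \sum_(i <- s) \sum_(j <- s)
    (complex.Re (b i * (b j)^*%C) * cos (2 * pi * (freq i - freq j)%:~R * t) +
     - complex.Im (b i * (b j)^*%C) * sin (2 * pi * (freq i - freq j)%:~R * t)).
Proof.
rewrite sqr_normc_Re /trig_poly rmorph_sum big_distrlr Re_sum.
apply: eq_bigr => i _.
rewrite Re_sum; apply: eq_bigr => j _.
rewrite rmorphB /= mulrBr mulrBl.
rewrite -[2 * pi * (freq i)%:~R * t]mulrA -[2 * pi * (freq j)%:~R * t]mulrA.
rewrite cosB sinB /e; case: (b i) => a1 a2; case: (b j) => c1 c2 /=.
ring.
Qed.

Lemma continuous_sqr_normc_trig_poly (I : Type) (s : seq I) (freq : I -> int)
    (b : I -> R[i]) :
  continuous (fun t => normc (trig_poly s freq b t) ^+ 2).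
Proof.
under eq_fun do rewrite sqr_normc_trig_poly.
apply: continuous_sumf => i; apply: continuous_sumf => j x.
apply: cvgD; apply: cvgM.
- exact: cvg_cst.
- exact: continuous_cosZ.
- exact: cvg_cst.
- exact: continuous_sinZ.
Qed.

(** Orthogonality leaves the pairs of equal frequency. Distinct indices may share a frequency, so
    these pairs can go beyond the diagonal. *)
Lemma mean_sqr_normc_trig_poly (I : Type) (s : seq I) (freq : I -> int)
    (b : I -> R[i]) :
  mean (fun t => normc (trig_poly s freq b t) ^+ 2) =
  \sum_(i <- s) \sum_(j <- s)
    complex.Re (b i * (b j)^*%C) * (freq i == freq j)%:R.
Proof.
under eq_fun do rewrite sqr_normc_trig_poly.
have cZcos (r c : R) : continuous (fun t => r * cos (c * t)).
  by move=> x; apply: cvgM; [exact: cvg_cst|exact: continuous_cosZ].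
have cZsin (r c : R) : continuous (fun t => r * sin (c * t)).
  by move=> x; apply: cvgM; [exact: cvg_cst|exact: continuous_sinZ].
rewrite mean_sum; last first.
  move=> i; apply: continuous_sumf => j x.
  by apply: cvgD; [exact: cZcos|exact: cZsin].
apply: eq_bigr => i _; rewrite mean_sum; last first.
  by move=> j x; apply: cvgD; [exact: cZcos|exact: cZsin].
apply: eq_bigr => j _; rewrite meanD// !meanZ; last 2 first.
- exact: continuous_sinZ.
- exact: continuous_cosZ.
by rewrite mean_cos mean_sin mulr0 addr0 subr_eq0.
Qed.

(** Parseval: when no frequency repeats, only the diagonal terms survive. *)
Lemma mean_sqr_normc_trig_poly_inj (I : eqType) (s : seq I) (freq : I -> int)
    (b : I -> R[i]) : uniq s -> {in s &, injective freq} ->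
  mean (fun t => normc (trig_poly s freq b t) ^+ 2) =
  \sum_(i <- s) normc (b i) ^+ 2.
Proof.
move=> us inj; rewrite mean_sqr_normc_trig_poly.
apply: eq_big_seq => i si; rewrite (bigD1_seq i)//= eqxx mulr1 sqr_normc_Re.
rewrite big_seq_cond big1 ?addr0// => j /andP[sj ji].
by rewrite (inj_in_eq inj)// eq_sym (negbTE ji) mulr0.
Qed.

Definition pairs (I : Type) (s : seq I) : seq (I * I) :=
  [seq (i, j) | i <- s, j <- s].

(** This turns fourth moments into second moments. Many pairs have the same frequency sum, hence the
    need for a second moment formula with repeated frequencies. *)
Lemma trig_poly_sqr (I : Type) (s : seq I) (freq : I -> int)
    (b : I -> R[i]) (t : R) :
  trig_poly s freq b t ^+ 2 =
  trig_poly (pairs s) (fun p => freq p.1 + freq p.2) (fun p => b p.1 * b p.2) t.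
Proof.
rewrite expr2 /trig_poly /pairs big_distrlr big_allpairs /=.
apply: eq_bigr => i _; apply: eq_bigr => j _.
by rewrite rmorphD /= mulrDl eD mulrACA.
Qed.

Lemma normc4_trig_poly (I : Type) (s : seq I) (freq : I -> int)
    (b : I -> R[i]) (t : R) :
  normc (trig_poly s freq b t) ^+ 4 =
  normc (trig_poly (pairs s) (fun p => freq p.1 + freq p.2)
    (fun p => b p.1 * b p.2) t) ^+ 2.
Proof. by rewrite -trig_poly_sqr normcX -exprM. Qed.

Lemma continuous_normc4_trig_poly (I : Type) (s : seq I) (freq : I -> int)
    (b : I -> R[i]) :
  continuous (fun t => normc (trig_poly s freq b t) ^+ 4).
Proof.
under eq_fun do rewrite normc4_trig_poly.
exact: continuous_sqr_normc_trig_poly.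
Qed.

(** The additive energy of the frequencies, counted over indices, so that repeated frequencies count
    with multiplicity. *)
Definition quadruples (I : Type) (s : seq I) (freq : I -> int) : R :=
  \sum_(p <- pairs s) \sum_(q <- pairs s)
    (freq p.1 + freq p.2 == freq q.1 + freq q.2)%:R.

Lemma mean_normc4_trig_poly1 (I : Type) (s : seq I) (freq : I -> int) :
  mean (fun t => normc (trig_poly s freq (fun=> 1) t) ^+ 4) = quadruples s freq.
Proof.
under eq_fun do rewrite normc4_trig_poly.
rewrite mean_sqr_normc_trig_poly; apply: eq_bigr => p _; apply: eq_bigr => q _.
by rewrite !mulr1 mul1r rmorph1 mul1r.
Qed.

(** Only two pairs of indices with equal frequency sums contribute, and the real part of their
    product of four coefficients is at most [c ^+ 4]. *)
Lemma mean_normc4_trig_poly_le (I : eqType) (s : seq I) (freq : I -> int)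
    (b : I -> R[i]) (c : R) : {in s, forall i, normc (b i) <= c} ->
  mean (fun t => normc (trig_poly s freq b t) ^+ 4) <=
  c ^+ 4 * quadruples s freq.
Proof.
move=> bc; under eq_fun do rewrite normc4_trig_poly.
have bc2 p : p \in pairs s -> normc (b p.1 * b p.2) <= c ^+ 2.
  case/allpairsP => -[i j] [si sj ->].
  by rewrite normcM expr2 ler_pM ?normc_ge0 ?bc.
rewrite mean_sqr_normc_trig_poly mulr_sumr.
rewrite big_seq [leRHS]big_seq; apply: ler_sum => p sp.
rewrite mulr_sumr big_seq [leRHS]big_seq; apply: ler_sum => q sq.
apply: ler_wpM2r; first exact: ler0n.
apply: le_trans (Re_le_normc _) _.
by rewrite normcM normc_conj (_ : 4 = 2 + 2)%N// exprD ler_pM ?normc_ge0 ?bc2.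
Qed.

(** The square of [rep_count E m] counts two pairs that both sum to [m]; summing over [m] first
    leaves the condition that the two sums agree. *)
Lemma quadruples_energy (I : choiceType) (s : seq I) (freq : I -> int) :
  uniq s -> {in s &, injective freq} ->
  energy R [fset freq i | i in s]%fset = quadruples s freq.
Proof.
move=> us inj.
(* Injectivity of [freq] on [s] matches pairs of indices with pairs of elements of the image, one to
   one. *)
have sumE (F : int * int -> R) :
    \sum_(p <- ([fset freq i | i in s] `*` [fset freq i | i in s])%fset) F p =
    \sum_(p <- pairs s) F (freq p.1, freq p.2).
  rewrite -(big_map (fun p => (freq p.1, freq p.2)) xpredT F).
  apply: perm_big; apply: uniq_perm; first exact: fset_uniq.
    rewrite map_inj_in_uniq; first by rewrite allpairs_uniq// => -[? ?] [? ?].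
    move=> _ _ /allpairsP[[i j] [si sj ->]] /allpairsP[[k l] [sk sl ->]] /= [].
    by move=> /inj -> // /inj ->.
  move=> [x y]; apply/idP/mapP => [|[p /allpairsP[[i j] [si sj ->]] [-> ->]]].
    rewrite in_fsetM /= => /andP[/imfsetP[i /= si ->] /imfsetP[j /= sj ->]].
    by exists (i, j) => //; exact: allpairs_f.
  by rewrite in_fsetM /= !in_imfset.
set E := [fset freq i | i in s]%fset in sumE *.
have repE m : (rep_count E m)%:R =
    \sum_(p <- pairs s) (freq p.1 + freq p.2 == m)%:R :> R.
  rewrite -(sumE (fun p => (p.1 + p.2 == m)%:R)) /rep_count.
  rewrite -sum1_size -big_fset_condE natr_sum big_mkcond /=.
  by apply: eq_bigr => p _; case: eqP.
rewrite /energy /quadruples.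
(* [S] lists the sumset without repetition; [rep_count] vanishes off it, so the sum over all
   integers becomes a finite one. *)
pose S := undup [seq freq p.1 + freq p.2 | p <- pairs s].
rewrite (@fsbigE _ _ _ _ _ S) ?undup_uniq//; last first.
  move=> m _; rewrite mem_undup => mS.
  rewrite repE big_seq big1 ?expr0n// => p ps.
  by case: eqP => // pm; move: mS; rewrite -pm (map_f (fun p => freq p.1 + freq p.2)).
under eq_bigr do rewrite repE expr2 big_distrlr /=.
rewrite (eq_bigl xpredT) => [|m]; last exact: mem_set.
rewrite exchange_big /=; apply: eq_big_seq => p sp.
rewrite exchange_big /=; apply: eq_bigr => q _.
have pS : freq p.1 + freq p.2 \in S.
  by rewrite mem_undup (map_f (fun p => freq p.1 + freq p.2)).
rewrite (bigD1_seq _ pS (undup_uniq _)) /=.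
rewrite eqxx mul1r big1 ?addr0 1?eq_sym// => m.
by rewrite eq_sym => /negbTE ->; rewrite mul0r.
Qed.

End trig_poly.

(** * Splitting the coefficients into dyadic levels *)

Lemma normc_sum4_le (R : realType) (I : Type) (s : seq I) (z : I -> R[i]) :
  normc (\sum_(i <- s) z i) ^+ 4 <=
  (size s)%:R ^+ 3 * \sum_(i <- s) normc (z i) ^+ 4.
Proof.
set n : R := (size s)%:R.
have n0 : 0 <= n by exact: ler0n.
have sq0 : 0 <= \sum_(i <- s) normc (z i) ^+ 2.
  by apply: sumr_ge0 => i _; exact: sqr_ge0.
(* Cauchy-Schwarz is used on the moduli and then on their squares. Squaring the first bound costs
   [n ^+ 2] and the second costs [n], which makes the cube. *)
have h1 : normc (\sum_(i <- s) z i) ^+ 2 <= n * \sum_(i <- s) normc (z i) ^+ 2.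
  apply: le_trans (sqr_sum_le _ _); apply: lerXn2r (normc_sum _ _).
    by rewrite nnegrE normc_ge0.
  by rewrite nnegrE sumr_ge0// => i _; exact: normc_ge0.
have h2 : (\sum_(i <- s) normc (z i) ^+ 2) ^+ 2 <= n * \sum_(i <- s) normc (z i) ^+ 4.
  by apply: le_trans (sqr_sum_le _ _) _; under eq_bigr do rewrite -exprM.
rewrite (exprM _ 2 2); apply: (@le_trans _ _ ((n * \sum_(i <- s) normc (z i) ^+ 2) ^+ 2)).
  by apply: lerXn2r h1; rewrite nnegrE ?sqr_ge0 ?mulr_ge0.
rewrite exprMn.
have -> : n ^+ 3 * \sum_(i <- s) normc (z i) ^+ 4 =
  n ^+ 2 * (n * \sum_(i <- s) normc (z i) ^+ 4) by ring.
by rewrite ler_wpM2l// sqr_ge0.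
Qed.

(* The last level [l = J] has no lower bound: it collects all small values. *)
Lemma dyadic_level (R : realType) (M x : R) (J : nat) : x <= M ->
  exists l : nat, [/\ (l <= J)%N, x <= M / 2 ^+ l &
    (l < J)%N -> M / 2 ^+ l.+1 < x].
Proof.
move=> xM; elim: J => [|J [l [lJ xl lx]]].
  by exists 0%N; split => //; rewrite expr0 divr1.
move: lJ; rewrite leq_eqVlt => /predU1P[lJ|lJ]; last first.
  by exists l; split; [exact/leqW/ltnW|by []|by move=> _; exact: lx].
have [xJ|xJ] := leP x (M / 2 ^+ J.+1).
  by exists J.+1; split => //; rewrite ltnn.
by exists J; split => //; rewrite -lJ.
Qed.

(** Each level costs [B * (4 * S) ^+ 2], whence the 16. Of the four powers of [J.+1], three come
    from [normc_sum4_le] and one from the number of levels. *)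
Lemma mean_normc4_le_of_quadruples (R : realType) (I : eqType) (s : seq I)
    (freq : I -> int) (b : I -> R[i]) (B : R) (J : nat) :
  uniq s -> {in s &, injective freq} -> 0 <= B -> (size s <= 2 ^ J)%N ->
  (forall P : pred I, quadruples [seq i <- s | P i] freq <=
     B * (size [seq i <- s | P i])%:R ^+ 2) ->
  mean (fun t => normc (trig_poly s freq b t) ^+ 4) <=
  16 * J.+1%:R ^+ 4 * B *
    mean (fun t => normc (trig_poly s freq b t) ^+ 2) ^+ 2.
Proof.
move=> us inj B0 sJ HB; rewrite mean_sqr_normc_trig_poly_inj//.
set S := \sum_(i <- s) normc (b i) ^+ 2.
have S0 : 0 <= S by apply: sumr_ge0 => i _; exact: sqr_ge0.
have sub_S (P : pred I) : \sum_(i <- [seq i <- s | P i]) normc (b i) ^+ 2 <= S.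
  rewrite big_filter /S [leRHS](bigID P)/= lerDl.
  by apply: sumr_ge0 => i _; exact: sqr_ge0.
pose M := Num.sqrt S.
have M2 : M ^+ 2 = S by rewrite sqr_sqrtr.
have M0 : 0 <= M by exact: sqrtr_ge0.
have bM i : i \in s -> normc (b i) <= M.
  move=> si; rewrite -(ger0_norm (normc_ge0 (b i))) -sqrtr_sqr ler_wsqrtr//.
  rewrite /S (bigD1_seq i)//= lerDl.
  by apply: sumr_ge0 => j _; exact: sqr_ge0.
(* The condition is void outside [s], so a level can be chosen for every index at once. *)
have /choice[lev levP] (i : I) : exists l : nat, i \in s ->
    [/\ (l <= J)%N, normc (b i) <= M / 2 ^+ l &
      (l < J)%N -> M / 2 ^+ l.+1 < normc (b i)].
  have [/bM/(dyadic_level J)[l hl]|_] := boolP (i \in s); first by exists l.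
  by exists 0%N.
pose s_ l := [seq i <- s | lev i == l].
(* Every index of [s] lies on exactly one level, so after exchanging the sums one term per index
   remains. *)
have decomp t : trig_poly s freq b t =
    \sum_(l <- iota 0 J.+1) trig_poly (s_ l) freq b t.
  rewrite /trig_poly; under [RHS]eq_bigr do rewrite big_filter big_mkcond.
  rewrite exchange_big /=; apply: eq_big_seq => i si.
  have lev_iota : lev i \in iota 0 J.+1.
    by rewrite mem_iota add0n ltnS; have [] := levP i si.
  rewrite (bigD1_seq (lev i) lev_iota (iota_uniq _ _)).
  by rewrite eqxx big1 /= ?addr0 // => l; rewrite eq_sym => /negbTE ->.
have le_level l : l \in iota 0 J.+1 ->
    mean (fun t => normc (trig_poly (s_ l) freq b t) ^+ 4) <= B * (4 * S) ^+ 2.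
  rewrite mem_iota /= add0n ltnS => lJ.
  have in_s j : j \in s_ l -> j \in s /\ lev j = l.
    by rewrite mem_filter => /andP[/eqP].
  pose c := M / 2 ^+ l.
  have c0 : 0 <= c by rewrite divr_ge0// exprn_ge0.
  apply: (@le_trans _ _ (c ^+ 4 * quadruples (s_ l) freq)).
    by apply: mean_normc4_trig_poly_le => i /in_s[/levP[_ h _] li]; rewrite /c -li.
  apply: (@le_trans _ _ (c ^+ 4 * (B * (size (s_ l))%:R ^+ 2))).
    by rewrite ler_wpM2l ?exprn_ge0//; exact: HB.
  have -> : c ^+ 4 * (B * (size (s_ l))%:R ^+ 2) =
    B * (c ^+ 2 * (size (s_ l))%:R) ^+ 2 by ring.
  rewrite ler_wpM2l// lerXn2r ?nnegrE ?mulr_ge0 ?sqr_ge0//.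
  (* On the last level, the assumption [size s <= 2 ^ J] replaces the lower bound: at most [2 ^ J]
     indices are weighed by [S / 4 ^ J] each. *)
  move: lJ; rewrite leq_eqVlt => /predU1P[lJ|lJ].
    rewrite /c lJ expr_div_n M2.
    apply: (@le_trans _ _ (S * 1)); last by lra.
    rewrite -mulrA ler_wpM2l// ler_pdivrMl ?exprn_gt0// mulr1.
    rewrite -exprM -natrX ler_nat (leq_trans (size_subseq (filter_subseq _ _)))//.
    by rewrite (leq_trans sJ)// leq_exp2l// leq_pmulr.
  (* On the other levels [c] is twice the lower bound for the moduli, so this is at most four times
     the sum of their squares. *)
  have -> : c ^+ 2 * (size (s_ l))%:R = 4 * \sum_(i <- s_ l) (M / 2 ^+ l.+1) ^+ 2.
    rewrite big_const_seq count_predT iter_addr_0 -mulr_natr.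
    rewrite (exprS (2 : R) l) /c; have : (2 : R) ^+ l != 0 by rewrite expf_neq0.
    by move=> ?; field.
  rewrite ler_wpM2l//; apply: le_trans (sub_S (fun i => lev i == l)).
  rewrite big_seq [leRHS]big_seq; apply: ler_sum => i /in_s[/levP[_ _ h] li].
  apply: lerXn2r; rewrite ?nnegrE ?normc_ge0 ?divr_ge0 ?exprn_ge0//.
  by apply: ltW; rewrite -li h// li.
apply: (@le_trans _ _ (mean (fun t => J.+1%:R ^+ 3 *
    \sum_(l <- iota 0 J.+1) normc (trig_poly (s_ l) freq b t) ^+ 4))).
  apply: mean_le; first exact: continuous_normc4_trig_poly.
    move=> t; apply: cvgM; first exact: cvg_cst.
    by apply: continuous_sumf => l; exact: continuous_normc4_trig_poly.
  move=> t; rewrite decomp; apply: le_trans (normc_sum4_le _ _) _.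
  by rewrite size_iota.
rewrite meanZ; last first.
  by apply: continuous_sumf => l; exact: continuous_normc4_trig_poly.
rewrite mean_sum; last by move=> l; exact: continuous_normc4_trig_poly.
apply: (@le_trans _ _ (J.+1%:R ^+ 3 * \sum_(l <- iota 0 J.+1) B * (4 * S) ^+ 2)).
  rewrite ler_wpM2l ?exprn_ge0// big_seq [leRHS]big_seq.
  exact: ler_sum.
rewrite big_const_seq count_predT size_iota iter_addr_0 -[(_ * _) *+ _]mulr_natr.
by rewrite le_eqVlt; apply/orP; left; apply/eqP; ring.
Qed.

(** * Norms as moments, sets of squares, and bounds on logarithms *)

Lemma Lpnorm_exp (R : realType) (n : nat) (f : R -> R[i]) : (0 < n)%N ->
  Lpnorm n%:R f ^+ n = mean (fun t => normc (f t) ^+ n).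
Proof.
move=> n0; rewrite /Lpnorm -powR_mulrn ?powR_ge0// -powRrM mulVf ?pnatr_eq0 -?lt0n//.
rewrite powRr1; last by apply: Rintegral_ge0 => t _; exact: powR_ge0.
by apply: eq_Rintegral => t _; rewrite powR_mulrn// normc_ge0.
Qed.

Definition sqz (k : nat) : int := (k ^ 2)%:Z.

Lemma sqz_inj : injective sqz.
Proof. by move=> i j [] /eqP; rewrite eqn_exp2r// => /eqP. Qed.

Lemma squares_polyE (R : realType) (N : nat) (a : nat -> R[i]) (t : R) :
  squares_poly N a t = trig_poly (iota 1 N) sqz a t.
Proof. by rewrite /squares_poly /trig_poly /index_iota subn1. Qed.

Lemma mem_squares (N : nat) (x : int) :
  reflect (exists2 k, k \in iota 1 N & x = sqz k) (x \in squares N).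
Proof. by apply: (iffP (imfsetP _ _ _ _)) => -[k kN ->]; exists k. Qed.

Lemma squares_polyD (R : realType) (N : nat) (P : pred nat) (t : R) :
  squares_poly N (fun k => if P k then 1 else 0) t =
  trig_poly [seq k <- iota 1 N | P k] sqz (fun=> 1) t.
Proof.
rewrite squares_polyE /trig_poly big_filter [RHS]big_mkcond /=.
by apply: eq_bigr => k _; case: (P k); rewrite ?mul0r.
Qed.

Lemma subset_squaresE (N : nat) (E : {fset int}) : (E `<=` squares N)%fset ->
  E = [fset sqz k | k in [seq k <- iota 1 N | sqz k \in E]]%fset.
Proof.
move=> EN; apply/fsetP => x; apply/idP/imfsetP => /= [xE|[k + ->]].
  have /mem_squares[k kN xk] := fsubsetP EN x xE.
  by exists k => //; rewrite mem_filter -xk xE.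
by rewrite mem_filter => /andP[].
Qed.

Lemma card_fset_sqz (s : seq nat) : uniq s ->
  #|` [fset sqz k | k in s]%fset | = size s.
Proof.
move=> us; rewrite -(size_map sqz); apply/perm_size/uniq_perm.
- exact: fset_uniq.
- by rewrite map_inj_uniq//; exact: sqz_inj.
- by move=> x; apply/imfsetP/mapP => -[k ks ->]; exists k.
Qed.

(** The factor [ln N ^ (r - c)] has exponent at most 0, so it is largest at [N = 2]. Since
    [ln 2 < 1], raising the exponent does cost a constant. *)
Lemma le_powR_log (R : realType) (N : nat) (r c : R) : (2 <= N)%N -> r <= c ->
  ln N%:R `^ r <= ln 2 `^ (r - c) * ln N%:R `^ c.
Proof.
move=> N2 rc.
have ln2 : 0 < ln 2 :> R by rewrite ln_gt0// ltr1n.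
have ln2N : ln 2 <= ln N%:R :> R by rewrite ler_ln ?posrE ?ltr0n ?ler_nat// ltnW.
have lnN : 0 < ln N%:R :> R by exact: lt_le_trans ln2N.
rewrite -[leLHS](_ : ln N%:R `^ (r - c) * ln N%:R `^ c = _); last first.
  by rewrite -powRD ?subrK// (gt_eqF lnN) implybT.
rewrite ler_wpM2r ?powR_ge0// -opprB !powRN lef_pV2 ?posrE ?powR_gt0//.
by rewrite ge0_ler_powR ?nnegrE ?subr_ge0// ltW.
Qed.

(** With [J = up_log 2 N], [2 ^ (J - 1) < N] gives [(J - 1) * ln 2 <= ln N]; the missing [2 * ln 2]
    is at most [2 * ln N]. *)
Lemma up_log_le_ln (R : realType) (N : nat) : (2 <= N)%N ->
  (up_log 2 N).+1%:R <= 3 / ln 2 * ln N%:R :> R.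
Proof.
move=> N2.
have ln2 : 0 < ln 2 :> R by rewrite ln_gt0// ltr1n.
have ln2N : ln 2 <= ln N%:R :> R by rewrite ler_ln ?posrE ?ltr0n ?ler_nat// ltnW.
have J0 : (0 < up_log 2 N)%N by rewrite up_log_gt0.
have /andP[/ltnW] := up_log_bounds (isT : (1 < 2)%N) N2.
rewrite -(ler_nat R) natrX => h _.
have {}h : (up_log 2 N).-1%:R * ln 2 <= ln N%:R :> R.
  rewrite -powR_mulrn// in h; rewrite -ln_powR ler_ln ?posrE ?powR_gt0//.
  by rewrite ltr0n ltnW.
rewrite mulrAC ler_pdivlMr// -(prednK J0).
by rewrite -[(_.-1).+2]addn2 natrD mulrDl; lra.
Qed.

(** * The two implications between the norm bound and the energy bound *)

Theorem theorem14 (R : realType) :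
  (exists delta K : R,
     forall (N : nat) (a : nat -> R[i]), (2 <= N)%N ->
       Lpnorm 4 (squares_poly N a) <=
         K * Lpnorm 2 (squares_poly N a) * ln N%:R `^ delta)
  <->
  (exists C K' : R,
     0 < C /\
     forall (N : nat) (E : {fset int}), (2 <= N)%N ->
       (E `<=` squares N)%fset ->
       energy R E <= K' * #|` E|%:R ^+ 2 * ln N%:R `^ C).

Proof.
split=> [[delta [K hL4]]|[C [K' [C0 hE]]]].
  (* [delta] may be negative or zero while [C] must be positive; [le_powR_log] pays for the larger
     exponent with a power of [ln 2]. *)
  exists (Num.max (4 * delta) 1).
  exists (K ^+ 4 * ln 2 `^ (4 * delta - Num.max (4 * delta) 1)).
  split=> [|N E N2 EN]; first by rewrite lt_max ltr01 orbT.
  set s := [seq k <- iota 1 N | sqz k \in E].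
  have us : uniq s by rewrite filter_uniq// iota_uniq.
  have Es : E = [fset sqz k | k in s]%fset by exact: subset_squaresE.
  have injs : {in s &, injective sqz} by move=> i j _ _; exact: sqz_inj.
  pose a k : R[i] := if sqz k \in E then 1 else 0.
  have aE : squares_poly N a = trig_poly s sqz (fun=> 1).
    by apply/funext => t; exact: squares_polyD.
  have L4 : Lpnorm 4 (squares_poly N a) ^+ 4 = energy R E.
    by rewrite Lpnorm_exp// aE mean_normc4_trig_poly1 Es quadruples_energy.
  have L2 : Lpnorm 2 (squares_poly N a) ^+ 2 = #|` E|%:R.
    rewrite Lpnorm_exp// aE mean_sqr_normc_trig_poly_inj// Es card_fset_sqz//.
    under eq_bigr do rewrite normc1 expr1n.
    by rewrite big_const_seq count_predT iter_addr_0.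
  have K_le := hL4 N a N2.
  have L4_ge0 : 0 <= Lpnorm 4 (squares_poly N a) by exact: powR_ge0.
  rewrite -L4 -L2; apply: (@le_trans _ _
      ((K * Lpnorm 2 (squares_poly N a) * ln N%:R `^ delta) ^+ 4)).
    (* [K] has no assumed sign: the right side is nonnegative because it dominates an [L^4] norm. *)
    by rewrite lerXn2r// nnegrE (le_trans L4_ge0).
  rewrite !exprMn -(powR_mulrn 4 (powR_ge0 (ln N%:R) delta)) -powRrM [delta * _]mulrC.
  rewrite -exprD (_ : 2 + 2 = 4)%N//; set Z := Lpnorm 2 _ ^+ 4.
  have -> (u v : R) : K ^+ 4 * u * Z * v = K ^+ 4 * Z * (u * v) by ring.
  rewrite ler_wpM2l//; first by rewrite mulr_ge0// exprn_even_ge0.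
  by rewrite le_powR_log// le_max lexx.
have [A A0 J_le] : exists2 A : R, 0 <= A &
    forall N, (2 <= N)%N -> (up_log 2 N).+1%:R <= A * ln N%:R.
  exists (3 / ln 2); first by rewrite divr_ge0// ltW// ln_gt0// ltr1n.
  exact: up_log_le_ln.
(* The fourth power of the norm picks up [L ^ C] from the energy and [L ^ 4] from the levels. The
   added 1 lets the constant dominate after a fourth power, without extracting a root; [K'] may be
   negative, hence its absolute value. *)
exists ((C + 4) / 4), (1 + 16 * A ^+ 4 * `|K'|) => N a N2.
set s := iota 1 N; pose L : R := ln N%:R; pose J := up_log 2 N.
have aE : squares_poly N a = trig_poly s sqz a.
  by apply/funext => t; exact: squares_polyE.
have L0 : 0 < L by rewrite ln_gt0// ltr1n.
set f := squares_poly N a.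
have main : Lpnorm 4 f ^+ 4 <=
    16 * J.+1%:R ^+ 4 * (`|K'| * L `^ C) * (Lpnorm 2 f ^+ 2) ^+ 2.
  rewrite [leLHS]Lpnorm_exp// [X in _ <= _ * X ^+ 2]Lpnorm_exp// /f aE.
  apply: mean_normc4_le_of_quadruples.
  - exact: iota_uniq.
  - by move=> i j _ _; exact: sqz_inj.
  - by rewrite mulr_ge0// powR_ge0.
  - by rewrite size_iota up_logP.
  (* Any sublist of [1, ..., N] gives a set of squares to which the energy bound applies with the
     same [N]. *)
  - move=> P; set sP := [seq i <- s | P i].
    have usP : uniq sP by rewrite filter_uniq// iota_uniq.
    rewrite -quadruples_energy//; last by move=> i j _ _; exact: sqz_inj.
    rewrite -(card_fset_sqz usP); set E := [fset sqz k | k in sP]%fset.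
    have EN : (E `<=` squares N)%fset.
      apply/fsubsetP => x /imfsetP[k /= + ->]; rewrite mem_filter => /andP[_ ks].
      by apply/mem_squares; exists k.
    apply: le_trans (hE N E N2 EN) _; rewrite mulrAC ler_wpM2r ?sqr_ge0//.
    by rewrite ler_wpM2r ?powR_ge0// ler_norm.
have {}J_le : J.+1%:R <= A * L by exact: J_le.
have K0 : 0 <= 16 * A ^+ 4 * `|K'|.
  exact: mulr_ge0 (mulr_ge0 (ler0n _ _) (exprn_ge0 _ A0)) (normr_ge0 _).
have X0 : 0 <= Lpnorm 4 f by exact: powR_ge0.
have Y0 : 0 <= Lpnorm 2 f by exact: powR_ge0.
move: (Lpnorm 4 f) (Lpnorm 2 f) X0 Y0 main => X Y X0 Y0 main.
rewrite -(@ler_pXn2r _ 4)// ?nnegrE; last first.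
  by rewrite mulr_ge0 ?powR_ge0// mulr_ge0// addr_ge0.
apply: le_trans main _; rewrite !exprMn.
rewrite -[(_ `^ ((C + 4) / 4)) ^+ 4]powR_mulrn ?powR_ge0// -powRrM divfK//.
rewrite powRD; last by rewrite (gt_eqF L0) implybT.
rewrite powR_mulrn; last exact: ltW.
have LC0 : 0 <= L `^ C by exact: powR_ge0.
have Y4 : 0 <= (Y ^+ 2) ^+ 2 by exact: sqr_ge0.
apply: (@le_trans _ _ (16 * (A * L) ^+ 4 * (`|K'| * L `^ C) * (Y ^+ 2) ^+ 2)).
  have AL0 : 0 <= A * L by exact: mulr_ge0 A0 (ltW L0).
  have KL0 : 0 <= `|K'| * L `^ C by exact: mulr_ge0 (normr_ge0 _) LC0.
  rewrite (ler_wpM2r Y4)// (ler_wpM2r KL0)// (ler_wpM2l (ler0n _ 16))//.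
  exact: lerXn2r (ler0n _ _) AL0 J_le.
have -> : 16 * (A * L) ^+ 4 * (`|K'| * L `^ C) * (Y ^+ 2) ^+ 2 =
  (16 * A ^+ 4 * `|K'|) * (Y ^+ 4 * (L `^ C * L ^+ 4)) by ring.
have W0 : 0 <= Y ^+ 4 * (L `^ C * L ^+ 4).
  exact: mulr_ge0 (exprn_ge0 _ Y0) (mulr_ge0 LC0 (exprn_ge0 _ (ltW L0))).
move: (16 * _ * _) K0 => x x0; rewrite -[leRHS]mulrA (ler_wpM2r W0)//.
(* [x <= 1 + x <= (1 + x) ^+ 4], the last because [1 + x] is at least 1. *)
apply: (@le_trans _ _ (1 + x)); first by rewrite lerDr.
by rewrite ler_eXnr// lerDl.
Qed.
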